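(* Let $n\ge 3$ be odd and let $P$ be a dense $2$-regular $(n,n,1,n(n-1)/2)$ PDA, whose associated graph is the complete graph $K_n$. Let $\{H_1,\dots,H_{(n-1)/2}\}$ be a set of edge-disjoint Hamiltonian cycles of $K_n$, with $H_i=\{e(s_{ij}): j\in\{1,\dots,n\}\}$. For $z\in\{1,2,\dots,(n-3)/2\}$, let $P_z$ be the array obtained from $P$ by replacing all entries equal to $s_{ij}$ by $\ast$, for all $1\le i\le z$ and $j\in\{1,\dots,n\}$. Then $P_z$ is a $2$-regular $(n,n,2z+1,n(n-2z-1)/2)$ PDA.
   Context: Notation: $[n]=\{0,1,\dots,n-1\}$. For positive integers $K,f$, a nonnegative integer $Z$ and a finite set $\mathcal{S}$ of integers, a $(K,f,Z,\mathcal{S})$ placement delivery array (PDA) is an $f\times K$ array $P=[p_{j,k}]$, $j\in[f]$, $k\in[K]$, with entries in $\mathcal{S}\cup\{\ast\}$ such that: (C1) $\ast$ appears exactly $Z$ times in each column; (C2) each $s\in\mathcal{S}$ occurs at least once; (C3, Blackburn property) if two distinct cells $(j_1,k_1)$, $(j_2,k_2)$ contain the same integer then $p_{j_1,k_2}=p_{j_2,k_1}=\ast$. The PDA is $g$-regular if each integer of $\mathcal{S}$ occurs exactly $g$ times. When a number $S$ is written in place of the set, it means that the integer set has exactly $S$ elements. Dense $2$-regular PDA: an $n\times n$ array obtained by setting all diagonal (or all anti-diagonal) cells to $\ast$, filling the $n(n-1)/2$ cells on one side of the diagonal (resp. anti-diagonal) with distinct integers, and filling the other side by reflection across the diagonal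 (resp. anti-diagonal). Associated graph: for a $2$-regular $(n,n,Z,\mathcal{S})$ PDA in which $s$ occurs in columns $j_1(s)$ and $j_2(s)$, $G(P)$ has vertex set $\{0,\dots,n-1\}$ and, for each $s\in\mathcal{S}$, an edge $e(s)$ joining $j_1(s)$ and $j_2(s)$. A Hamiltonian cycle is a cycle (identified with its set of $n$ edges) passing through all $n$ vertices. *)

(* Defs.v *)
From HB Require Import structures.
From mathcomp Require Import all_boot all_order all_algebra.
From mathcomp Require Import finmap.

Set Implicit Arguments.
Unset Strict Implicit.
Unset Printing Implicit Defensive.

Local Open Scope nat_scope.

(* Arrays have f rows and K columns; the entry [None] stands for the star. *)
Definition array (f K : nat) := 'M[option int]_(f, K).

Definition is_pda (K f Z : nat) (S : {fset int}) (P : array f K) : Prop :=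
  [/\ 0 < K /\ 0 < f,
      forall j k s, P j k = Some s -> s \in S,
      forall k : 'I_K, #|[set j : 'I_f | P j k == None]| = Z,
      forall s, s \in S -> exists j k, P j k = Some s
    & forall (j1 j2 : 'I_f) (k1 k2 : 'I_K) (s : int),
        (j1, k1) <> (j2, k2) -> P j1 k1 = Some s -> P j2 k2 = Some s ->
        P j1 k2 = None /\ P j2 k1 = None].

Definition is_regular (g K f : nat) (S : {fset int}) (P : array f K) : Prop :=
  forall s, s \in S ->
    #|[set c : 'I_f * 'I_K | P c.1 c.2 == Some s]| = g.

Definition is_regular_pda (g K f Z : nat) (S : {fset int}) (P : array f K) :
    Prop :=
  is_pda Z S P /\ is_regular g S P.

Definition is_regular_pda_card (g K f Z N : nat) (P : array f K) : Prop :=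
  exists2 S : {fset int}, #|` S|%fset = N & is_regular_pda g Z S P.

Section Dense.

Variable n : nat.
Implicit Types (P : array n n) (c : 'I_n * 'I_n).

(* [axis]: the starred cells; [side]: the cells on one side of the axis, filled
   with distinct integers; [refl]: the reflection across the axis. *)
Definition filled_by_reflection (axis side : pred ('I_n * 'I_n))
    (refl : 'I_n * 'I_n -> 'I_n * 'I_n) P : Prop :=
  (forall c, axis c -> P c.1 c.2 = None) /\
  exists2 v : 'I_n * 'I_n -> int,
    {in side &, injective v} &
    forall c, side c ->
      P c.1 c.2 = Some (v c) /\ P (refl c).1 (refl c).2 = Some (v c).

(* Filling the other side of the axis first yields the same arrays, so it is
   enough to start from the cells above the diagonal or anti-diagonal. *)
Definition dense_diag P : Prop :=
  filled_by_reflection (fun c => c.1 == c.2) (fun c => c.1 < c.2)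
    (fun c => (c.2, c.1)) P.

Definition dense_antidiag P : Prop :=
  filled_by_reflection (fun c => c.1 + c.2 == n.-1) (fun c => c.1 + c.2 < n.-1)
    (fun c => (rev_ord c.2, rev_ord c.1)) P.

Definition is_dense P : Prop := dense_diag P \/ dense_antidiag P.

End Dense.

(* e(s): the set of the columns in which s occurs. In a 2-regular PDA the two
   occurrences of s are in distinct columns, by the Blackburn property. *)
Definition edge (n : nat) (P : array n n) (s : int) : {set 'I_n} :=
  [set k | [exists j, P j k == Some s]].

Definition complete_graph (V : finType) : {set {set V}} :=
  [set A : {set V} | #|A| == 2].

(* The multigraph with one edge e(s) for each s in S has no repeated edge, and
   its edge set is E. *)
Definition assoc_graph_is (n : nat) (S : {fset int}) (P : array n n)
    (E : {set {set 'I_n}}) : Prop :=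
  {in S &, injective (edge P)} /\ [set edge P (val s) | s : S] = E.

(* [H] is the edge set of a cycle through all the vertices of the graph on [V]
   with edge set [E]. *)
Definition hamiltonian_cycle (V : finType) (E H : {set {set V}}) : Prop :=
  exists c : seq V,
    [/\ 2 < size c,
        ucycle (fun x y => [set x; y] \in E) c,
        forall x : V, x \in c
      & H = [set [set x; next c x] | x : V]].

Definition star_out (f K : nat) (A : pred int) (P : array f K) : array f K :=
  map_mx (fun x => if x is Some v then if A v then None else Some v else None) P.

(* Main.v *)
(* Up to a permutation of its rows a dense array is a symmetric one with starred
   diagonal, whose integers label the pairs of distinct columns bijectively; so
   its graph is complete, and the cell (j, k) becomes a star of P_z exactly when
   j = k or {j, k} lies in one of the z chosen cycles. As each cycle has degree
   2 at k, column k then has 2z + 1 stars. The number of remaining integers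
   follows by counting the non-star cells twice. *)
Require Import Defs.
From HB Require Import structures.
From mathcomp Require Import all_boot all_order all_algebra.
From mathcomp Require Import finmap zify.

Local Open Scope nat_scope.

Lemma prev_at_notin (T : eqType) (x y : T) (p : seq T) :
  x \notin p -> prev_at x x y p = last y p.
Proof.
elim: p y => [|w p IHp] y /=; first by rewrite eqxx.
by rewrite inE negb_or => /andP[/negPf-> /IHp].
Qed.

(** Rotate the cycle so that [x] comes first. Its successor is then the second element and its
    predecessor the last one, and these differ as soon as there are three distinct elements. *)
Lemma next_neq_prev (T : eqType) (c : seq T) (x : T) :
  uniq c -> 2 < size c -> x \in c -> next c x != prev c x.
Proof.
move=> uc sc xc; have [i p def_c] := rot_to xc.
rewrite -(next_rot i uc) -(prev_rot i uc).
move: uc sc; rewrite -(rot_uniq i) -(size_rot i) def_c.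
case: p {def_c} => [|y [|w t]] // /andP[x_p /andP[y_p _]] _.
rewrite [next _ _]/= eqxx [prev _ _]prev_at_notin //.
by apply: contraNneq y_p => /= ->; exact: mem_last.
Qed.

Lemma set2_injl (T : finType) (x y z : T) : [set x; z] = [set y; z] -> x = y.
Proof.
move=> e; have := set21 y z; rewrite -e => /set2P[-> //|yz].
by have := set21 x z; rewrite e yz => /set2P[].
Qed.

(** The neighbours of [k] on the cycle are [next c k] and [prev c k], two distinct vertices. *)
Lemma hamiltonian_cycle_degree (V : finType) (H : {set {set V}}) (k : V) :
  hamiltonian_cycle (complete_graph V) H -> #|[set j | [set j; k] \in H]| = 2.
Proof.
case=> c [sc /andP[_ uc] cV ->].
rewrite (_ : [set j | _] = [set next c k; prev c k]); last first.
  apply/setP=> j; rewrite !inE; apply/imsetP/orP.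
    case=> x _ e; have : k \in [set x; next c x] by rewrite -e !inE eqxx orbT.
    rewrite !inE => /orP[]/eqP kE.
      by left; move: e; rewrite -kE [[set k; _]]setUC => /set2_injl->.
    by right; move: e; rewrite -kE => /set2_injl->; rewrite kE prev_next.
  case=> /eqP->; first by exists k; rewrite // setUC.
  by exists (prev c k); rewrite // next_prev.
by rewrite cards2 next_neq_prev.
Qed.

(** Both sides count the non-star cells: by integer on the left, by column on the right. *)
Lemma regular_pda_count (g K f Z : nat) (S : {fset int}) (P : array f K) :
  is_regular_pda g Z S P -> #|` S|%fset * g = K * (f - Z).
Proof.
case=> -[_ PS stars _ _] reg.
have -> : #|` S|%fset * g = \sum_(k < K) \sum_(j < f) (P j k != None).
  rewrite exchange_big pair_big /= cardfE -sum_nat_const.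
  rewrite (eq_bigr (fun s : S => \sum_c nat_of_bool (P c.1 c.2 == Some (val s)))).
    rewrite exchange_big; apply: eq_bigr => c _ /=.
    (* A star contributes to no integer, and any other cell only to the integer [w] that it
       contains. *)
    case Pc: (P c.1 c.2) => [v|]; last by rewrite big1.
    pose w : S := [` PS _ _ _ Pc]%fset.
    rewrite (bigD1 w) //= eqxx big1 // => s sw.
    by apply/eqP; rewrite eqb0; apply: contra sw => /eqP[vs]; apply/eqP/val_inj.
  by move=> s _; rewrite -(reg _ (valP s)) cardsE -sum1_card big_mkcond.
rewrite -[K in RHS]card_ord -sum_nat_const; apply: eq_bigr => k _.
have := cardsC [set j | P j k == None].
rewrite stars card_ord => /(congr1 (subn^~ Z)); rewrite addKn => <-.
by rewrite -sum1_card [RHS]big_mkcond; apply: eq_bigr => j _; rewrite !inE.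
Qed.

(** Surviving integers keep their cells and old stars remain stars, so the Blackburn property is
    inherited from [P]. Only the number of stars per column has to be supplied. *)
Lemma star_out_pda (K f Z Z' : nat) (S : {fset int}) (A : pred int)
    (P : array f K) :
    is_pda Z S P ->
    (forall k, #|[set j | star_out A P j k == None]| = Z') ->
  is_pda Z' [fset s in S | ~~ A s]%fset (star_out A P).
Proof.
case=> KF PS _ SP bl stars.
have soE j k s : star_out A P j k = Some s <-> P j k = Some s /\ ~~ A s.
  rewrite mxE; case: (P j k) => [v|]; last by split=> // -[].
  by case: ifPn => Av; split=> [|[]] // [<-] //; rewrite Av.
have soN j k : P j k = None -> star_out A P j k = None by rewrite mxE => ->.
split=> //.
- by move=> j k s /soE[/PS Ss As]; rewrite !inE Ss.
- by move=> s; rewrite !inE => /andP[/SP[j [k Pjk]] As]; exists j, k; apply/soE.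
- move=> j1 j2 k1 k2 s ne /soE[P1 _] /soE[P2 _].
  by case: (bl _ _ _ _ _ ne P1 P2); split; exact: soN.
Qed.

(** [A] depends on the integer alone, so either all occurrences of an integer are starred or none
    is. *)
Lemma star_out_regular (g K f : nat) (S : {fset int}) (A : pred int)
    (P : array f K) :
  is_regular g S P -> is_regular g [fset s in S | ~~ A s]%fset (star_out A P).
Proof.
move=> reg s; rewrite !inE => /andP[Ss As]; rewrite -(reg s Ss).
apply: eq_card => c; rewrite !inE mxE; case: (P _ _) => [v|] //.
by case: ifPn => // Av; apply/esym/eqP => -[vs]; rewrite -vs Av in As.
Qed.

Section DenseDiagonal.

Variables (n : nat) (Q : array n n).
Hypothesis dQ : dense_diag Q.

Lemma dense_diag_sym j k : Q j k = Q k j.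
Proof.
case: dQ => _ [v _ Qv]; case: (ltngtP j k) => [jk|kj|/val_inj-> //].
  by case: (Qv (j, k) jk) => /= -> ->.
by case: (Qv (k, j) kj) => /= -> ->.
Qed.

Lemma dense_diag_None j k : (Q j k == None) = (j == k).
Proof.
case: dQ => Q0 [v _ Qv]; case: (ltngtP j k) => [jk|kj|/val_inj->].
- by case: (Qv (j, k) jk) => /= -> _; apply/esym/negbTE; rewrite neq_ltn jk.
- by case: (Qv (k, j) kj) => /= _ ->; apply/esym/negbTE; rewrite neq_ltn kj orbT.
by rewrite (Q0 (k, k)) /= ?eqxx.
Qed.

(** By symmetry each filled cell can be moved above the diagonal without changing its pair of
    indices, and there the labelling is injective. *)
Lemma dense_diag_inj j k j' k' s :
  Q j k = Some s -> Q j' k' = Some s -> [set j; k] = [set j'; k'].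
Proof.
have sortQ a b : Q a b = Some s -> exists c : 'I_n * 'I_n,
    [/\ c.1 < c.2, Q c.1 c.2 = Some s & [set a; b] = [set c.1; c.2]].
  move=> Qab; case: (ltngtP a b) => [ab|ba|/val_inj ab].
  - by exists (a, b).
  - by exists (b, a); rewrite /= dense_diag_sym setUC.
  by move/eqP: ab; rewrite -dense_diag_None Qab.
move=> /sortQ[c [lt_c Qc ->]] /sortQ[d [lt_d Qd ->]].
case: dQ => _ [v v_inj Qv]; suff -> : c = d by [].
apply: v_inj => //; apply/Some_inj.
by case: (Qv c lt_c) => <- _; case: (Qv d lt_d) => <- _; rewrite Qc Qd.
Qed.

Lemma edge_dense_diag j k s : Q j k = Some s -> edge Q s = [set j; k].
Proof.
move=> Qjk; apply/setP=> l; rewrite [LHS]inE; apply/existsP/idP.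
  by case=> i /eqP/(dense_diag_inj _ _ _ _ _ Qjk)->; rewrite !inE eqxx orbT.
rewrite !inE => /orP[]/eqP->; last by exists j; rewrite Qjk.
by exists k; rewrite dense_diag_sym Qjk.
Qed.

(** Every pair of distinct columns [j], [k] is the edge of exactly one integer, the one in cell
    [(j, k)]. *)
Lemma assoc_graph_dense_diag (S : {fset int}) :
    (forall j k s, Q j k = Some s -> s \in S) ->
    (forall s, s \in S -> exists j k, Q j k = Some s) ->
  assoc_graph_is S Q (complete_graph 'I_n).
Proof.
move=> QS SQ; split.
  move=> s t /SQ[j [k Qs]] /SQ[j' [k' Qt]].
  rewrite (edge_dense_diag _ _ _ Qs) (edge_dense_diag _ _ _ Qt) => e.
  apply: Some_inj; rewrite -Qs -Qt.
  have := set21 j k; rewrite e => /set2P[] jE; subst j.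
    by move: e; rewrite ![[set j'; _]]setUC => /set2_injl->.
  move: e; rewrite [[set k'; _]]setUC => /set2_injl->; exact: dense_diag_sym.
apply/setP=> E; rewrite inE; apply/imsetP/cards2P.
  case=> s _ ->; have [j [k Qs]] := SQ _ (valP s).
  by exists j, k; rewrite -dense_diag_None Qs (edge_dense_diag _ _ _ Qs).
case=> j [k [jk ->]]; case Qjk: (Q j k) => [s|]; last first.
  by move/eqP: Qjk; rewrite dense_diag_None (negPf jk).
by exists [` QS _ _ _ Qjk]%fset; rewrite // (edge_dense_diag _ _ _ Qjk).
Qed.

End DenseDiagonal.

(** Reversing the rows carries the anti-diagonal to the diagonal and turns reflection across it into
    transposition. *)
Lemma dense_rowsub_diag (n : nat) (P : array n n) :
  is_dense P -> exists2 r : 'I_n -> 'I_n, involutive r & dense_diag (rowsub r P).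
Proof.
case=> [dP|[P0 [v v_inj Pv]]].
  exists id => //; suff -> : rowsub id P = P by [].
  by apply/matrixP=> j k; rewrite mxE.
exists (@rev_ord n); first exact: rev_ordK.
have rev_lt (c : 'I_n * 'I_n) : c.1 < c.2 -> rev_ord c.2 + c.1 < n.-1.
  by case: c => [[a ha] [b hb]] /=; lia.
split=> [c /eqP c12|].
  rewrite mxE; apply: (P0 (_, _)) => /=; rewrite c12.
  by case: c.2 => /= b hb; lia.
(* After the row reversal, a cell [c] above the diagonal comes from the far side of the
   anti-diagonal; [(rev_ord c.2, c.1)] is its mirror image on the side labelled by [v]. *)
exists (fun c => v (rev_ord c.2, c.1)).
  move=> [a b] [c d] /rev_lt lt_ab /rev_lt lt_cd.
  move=> /(v_inj (_, _) (_, _) lt_ab lt_cd) e.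
  by move: (congr1 fst e) (congr1 snd e) => /= /rev_ord_inj-> ->.
move=> c /rev_lt lt_c; rewrite !mxE.
by case: (Pv (_, _) lt_c) => /= <-; rewrite rev_ordK.
Qed.

(** Permuting rows keeps each integer in its columns; this transfers the graph from the diagonal
    form back to [P]. *)
Lemma edge_rowsub (n : nat) (r : 'I_n -> 'I_n) (P : array n n) (s : int) :
  involutive r -> edge (rowsub r P) s = edge P s.
Proof.
move=> rK; apply/setP=> k; rewrite !inE; apply/existsP/existsP=> -[j].
  by rewrite mxE => ?; exists (r j).
by exists (r j); rewrite mxE rK.
Qed.

Theorem corollary6 (n : nat) (hn : 3 <= n) (hodd : odd n)
    (S : {fset int}) (P : array n n)
    (hP : @is_regular_pda 2 n n 1 S P) (hS : #|` S|%fset = (n * (n - 1)) %/ 2)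
    (hdense : is_dense P) :
  assoc_graph_is S P (complete_graph 'I_n) /\
  forall (H : 'I_((n - 1) %/ 2) -> {set {set 'I_n}})
         (s : 'I_((n - 1) %/ 2) -> 'I_n -> int) (z : nat),
    (forall i, hamiltonian_cycle (complete_graph 'I_n) (H i)) ->
    (forall i1 i2, i1 != i2 -> [disjoint H i1 & H i2]) ->
    (forall i j, s i j \in S) ->
    (forall i, H i = [set edge P (s i j) | j : 'I_n]) ->
    1 <= z <= (n - 3) %/ 2 ->
    @is_regular_pda_card 2 n n (2 * z + 1) ((n * (n - 2 * z - 1)) %/ 2)
      (star_out
         (fun v => [exists i : 'I_((n - 1) %/ 2), exists j : 'I_n,
                      (i < z) && (v == s i j)]) P).
Proof.
case: (hP) => pdaP regP; case: (pdaP) => _ PS _ SP _.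
have [r rK dQ] := dense_rowsub_diag _ _ hdense.
set Q := rowsub r P in dQ.
have edgeQ s : edge Q s = edge P s by exact: edge_rowsub.
have gQ : assoc_graph_is S Q (complete_graph 'I_n).
  apply: assoc_graph_dense_diag => // [j k s|s /SP[j [k Pjk]]].
    by rewrite mxE => /PS.
  by exists (r j), k; rewrite mxE rK.
have gP : assoc_graph_is S P (complete_graph 'I_n).
  case: gQ => edge_inj <-; split=> [s t|].
    by rewrite -!edgeQ; exact: edge_inj.
  by apply: eq_imset => s; rewrite edgeQ.
split=> // H s z Hham Hdisj Ss HE /andP[_ z_le].
set A : pred int := fun v => _.
(* Since [edge P] is injective on [S], being one of the [s i j] can be tested on edges. *)
have AE v : v \in S ->
    A v = [exists i : 'I_((n - 1) %/ 2), (i < z) && (edge P v \in H i)].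
  move=> Sv; apply: eq_existsb => i; apply/existsP/andP.
    by case=> j /andP[-> /eqP->]; rewrite HE imset_f.
  case=> iz; rewrite HE => /imsetP[j _ /(proj1 gP _ _ Sv (Ss i j))->].
  by exists j; rewrite iz eqxx.
have stars k : #|[set j | star_out A P j k == None]| = 2 * z + 1.
  (* [B i] holds the neighbours of [k] in a chosen cycle and is empty for the other cycles. With
     rows renumbered by [r], the stars of column [k] are the diagonal one and those in the sets
     [B i], which are disjoint because the cycles are. *)
  pose B (i : 'I_((n - 1) %/ 2)) := [set j | (i < z) && ([set j; k] \in H i)].
  rewrite -(card_imset _ (inv_inj rK)).
  rewrite (_ : r @: _ = k |: \bigcup_i B i).
    rewrite cardsU1 -sum1_card partition_disjoint_bigcup => [|i1 i2 ne_i]; last first.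
      apply/pred0P=> j /=; rewrite !inE; apply/negbTE/negP.
      case/andP=> /andP[_ H1] /andP[_].
      by rewrite (disjointFr (Hdisj _ _ ne_i) H1).
    rewrite addnC; congr (_ + _).
      have z_le' : z <= (n - 1) %/ 2.
        exact/(leq_trans z_le)/leq_div2r/leq_sub2l.
      transitivity (\sum_(i < (n - 1) %/ 2 | i < z) 2); last first.
        by rewrite -(big_ord_widen _ (fun=> 2) z_le') sum_nat_const card_ord mulnC.
      rewrite [RHS]big_mkcond; apply: eq_bigr => i _; rewrite sum1_card.
      rewrite /B; case: (i < z) => /=; last by apply: eq_card0 => j; rewrite inE.
      exact: hamiltonian_cycle_degree.
    (* The diagonal star is not counted twice: [[set k; k]] is a singleton, whereas every edge has
       two vertices. *)
    suff -> : k \notin \bigcup_i B i by [].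
    apply/bigcupP => -[i _]; rewrite inE HE => /andP[_ /imsetP[j _ e]].
    have : edge P (s i j) \in complete_graph 'I_n.
      by rewrite -(proj2 gP); apply/imsetP; exists [` Ss i j]%fset.
    by rewrite -e inE cards2 eqxx.
  apply/setP=> j; rewrite -{1}[j]rK mem_imset; last exact: inv_inj.
  rewrite !inE mxE -(dense_diag_None _ _ dQ).
  have QP : Q j k = P (r j) k by rewrite mxE.
  rewrite QP; case Pjk: (P (r j) k) => [v|] //=.
  rewrite AE; last exact: PS Pjk.
  rewrite -edgeQ (edge_dense_diag _ _ dQ _ _ _ (etrans QP Pjk)).
  apply/idP/bigcupP; last first.
    by case=> i _; rewrite inE => iH; case: existsP => // -[]; exists i.
  by case: existsP => // -[i iH]; exists i; rewrite ?inE.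
have regPz :
    is_regular_pda 2 (2 * z + 1) [fset v in S | ~~ A v]%fset (star_out A P).
  by split; [exact: star_out_pda pdaP stars | exact: star_out_regular].
exists [fset v in S | ~~ A v]%fset => //.
(* The double count shows that the product is twice the number of surviving integers, so the
   division by 2 is exact. *)
by rewrite -subnDA -(regular_pda_count _ _ _ _ _ _ regPz) mulnK.
Qed.
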